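(* For every $g \geq 2$, the linearization map $\Phi\colon \mathfrak{H}_g \rightarrow H$, defined on generators by $\Phi([v]_{\mathrm{Sp}}) = v$, is an isomorphism of $\mathbb{Q}$-vector spaces.
   Context: $H = \mathbb{Q}^{2g}$ and $H_{\mathbb{Z}} = \mathbb{Z}^{2g} \subset H$, and $\omega\colon H \times H \to \mathbb{Q}$ is the standard symplectic form (integral and unimodular on $H_{\mathbb{Z}}$). A set of vectors in a finitely generated free abelian group is a partial basis if it can be extended to a basis; a vector $v$ is primitive if $\{v\}$ is a partial basis. $\mathfrak{H}_g$ is the $\mathbb{Q}$-vector space with the following presentation. Generators: a formal symbol $[v]_{\mathrm{Sp}}$ for all primitive vectors $v \in H_{\mathbb{Z}}$. Relations: for every partial basis $\{v_1,v_2\}$ of $H_{\mathbb{Z}}$ with $\omega(v_1,v_2)=0$, the relation $[v_1]_{\mathrm{Sp}}+[v_2]_{\mathrm{Sp}} = [v_1+v_2]_{\mathrm{Sp}}$. The formula $\Phi([v]_{\mathrm{Sp}})=v$ takes relations to relations, so it gives a well-defined linear map. *)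

(* Defs.v *)
From HB Require Import structures.
From mathcomp Require Import all_boot all_order all_algebra.
From mathcomp Require Import boolp.
From mathcomp Require Import freeg.

Set Implicit Arguments.
Unset Strict Implicit.
Unset Printing Implicit Defensive.

Import GRing.Theory.
Local Open Scope ring_scope.
Local Open Scope quotient_scope.

(* K-modules given by generators and relations: the quotient of the free
   K-module {freeg X / K} by the linear span of the relators, i.e. of the
   elements [r] such that [rels r] (the relation being r = 0). *)
Section Presentation.
Variables (K : nzRingType) (X : choiceType) (rels : {freeg X / K} -> Prop).

Definition rel_span : {pred {freeg X / K}} := fun x =>
  `[< exists s : seq (K * {freeg X / K}),
        (forall p, p \in s -> rels p.2) /\ x = \sum_(p <- s) p.1 *: p.2 >].

Lemma rel_span_submod_closed : submod_closed rel_span.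
Proof.
split; first by apply/asboolP; exists [::]; split=> //; rewrite big_nil.
move=> a x y /asboolP[s [sR ->]] /asboolP[t [tR ->]]; apply/asboolP.
exists ([seq (a * p.1, p.2) | p <- s] ++ t); split.
  move=> p; rewrite mem_cat => /orP[/mapP[q qs ->]|/tR//].
  exact: (sR q qs).
rewrite big_cat big_map scaler_sumr; congr (_ + _).
by apply: eq_bigr => p _; rewrite scalerA.
Qed.

HB.instance Definition _ :=
  GRing.isSubmodClosed.Build K {freeg X / K} rel_span rel_span_submod_closed.

Definition presented : Type := Quotient.quot rel_span.

HB.instance Definition _ := ZmodQuotient.on presented.

Definition presented_scale (a : K) (x : presented) : presented :=
  \pi_presented (a *: repr x).

Lemma pi_presentedZ a x :
  \pi_presented (a *: x) = presented_scale a (\pi_presented x).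
Proof.
apply/eqP; rewrite /presented_scale -Quotient.idealrBE -scalerBr.
by apply: rpredZ; rewrite Quotient.idealrBE reprK.
Qed.

Fact presented_scaleA a b x :
  presented_scale a (presented_scale b x) = presented_scale (a * b) x.
Proof. by rewrite -[x]reprK -!pi_presentedZ scalerA reprK. Qed.

Fact presented_scale1 : left_id 1 presented_scale.
Proof. by move=> x; rewrite -[x]reprK -pi_presentedZ scale1r. Qed.

Fact presented_scaleDr : right_distributive presented_scale +%R.
Proof.
move=> a x y; rewrite -[x]reprK -[y]reprK -raddfD -!pi_presentedZ.
by rewrite scalerDr raddfD.
Qed.

Fact presented_scaleDl x : {morph presented_scale^~ x : a b / a + b}.
Proof. by move=> a b; rewrite -[x]reprK -!pi_presentedZ scalerDl raddfD. Qed.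

HB.instance Definition _ := GRing.Zmodule_isLmodule.Build K presented
  presented_scaleA presented_scale1 presented_scaleDr presented_scaleDl.

Definition pgen (x : X) : presented := \pi_presented << x >>.

End Presentation.

Section PresentationLift.
Variables (K : nzRingType) (X : choiceType) (rels : {freeg X / K} -> Prop).
Variables (M : lmodType K) (f : X -> M).
Hypothesis f_rels : forall r, rels r -> fglift f r = 0.

HB.instance Definition _ :=
  GRing.isZmodMorphism.Build {freeg X / K} M (fglift f) (lift_is_additive f).

Lemma fgliftZ a x : fglift f (a *: x) = a *: fglift f x.
Proof.
rewrite [a *: x]/(fgscale a x) /fgscale raddf_sum.
rewrite -[in RHS](freeg_sumE x) raddf_sum scaler_sumr.
by apply: eq_bigr => k _; rewrite /= !liftU scalerA.
Qed.

Lemma fglift_rel_span x : x \in rel_span rels -> fglift f x = 0.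
Proof.
move=> /asboolP[s [sR ->]]; rewrite raddf_sum big_seq big1 /= // => p ps.
by rewrite fgliftZ f_rels ?scaler0 //; apply: sR.
Qed.

Definition plift (x : presented rels) : M := fglift f (repr x).

Lemma plift_pi x : plift (\pi_(presented rels) x) = fglift f x.
Proof.
apply/eqP; rewrite -subr_eq0 /plift -raddfB; apply/eqP/fglift_rel_span.
by rewrite Quotient.idealrBE reprK.
Qed.

Fact plift_is_linear : linear plift.
Proof.
move=> a x y; rewrite -[x]reprK -[y]reprK.
rewrite -[a *: _]pi_presentedZ -raddfD !plift_pi.
by rewrite raddfD /= fgliftZ.
Qed.

Definition plin : {linear presented rels -> M} :=
  HB.pack plift (GRing.isLinear.Build _ _ _ _ plift plift_is_linear).

Lemma plin_pgen x : plin (pgen rels x) = f x.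
Proof. by rewrite [LHS]plift_pi liftU scale1r. Qed.

End PresentationLift.

Definition is_zbasis (M : zmodType) (s : seq M) : Prop :=
  forall w : M, exists! c : {ffun 'I_(size s) -> int},
    w = \sum_(i < size s) s`_i *~ c i.

(* A finite set of vectors is given by a list of its elements; the uniqueness
   in [is_zbasis] forces these to be pairwise distinct. *)
Definition partial_basis (M : zmodType) (s : seq M) : Prop :=
  exists t : seq M, is_zbasis (s ++ t).

Definition primitive (M : zmodType) (v : M) : Prop := partial_basis [:: v].

Lemma partial_basisD (M : zmodType) (u v : M) :
  partial_basis [:: u; v] -> primitive (u + v).
Proof.
case=> t tb; exists (v :: t) => w.
set n := size t.
pose S (x y : M) (c : {ffun 'I_n.+2 -> int}) :=
  \sum_(i < n.+2) [:: x, y & t]`_i *~ c i.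
pose i1 : 'I_n.+2 := fintype.lift ord0 ord0.
have SE x y c : S x y c = x *~ c ord0 + (y *~ c i1 +
    \sum_(i < n) t`_i *~ c (fintype.lift ord0 (fintype.lift ord0 i))).
  by rewrite /S !big_ord_recl.
pose sh (e : int) (c : {ffun 'I_n.+2 -> int}) : {ffun 'I_n.+2 -> int} :=
  [ffun i => if i == i1 then c i + e * c ord0 else c i].
have Ssh c : S (u + v) v c = S u v (sh 1 c).
  rewrite !SE !ffunE /= mul1r.
  under [in RHS]eq_bigr => i _ do rewrite ffunE /=.
  by rewrite mulrzDl mulrzDr -!addrA; congr (_ + _); rewrite [RHS]addrCA.
have shK e c : sh (- e) (sh e c) = c.
  apply/ffunP => i; rewrite !ffunE /=.
  by case: eqP => // ->; rewrite mulNr addrK.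
have [c [cw cu]] := tb w.
exists (sh (-1) c); split.
  rewrite -[RHS]/(S (u + v) v (sh (-1) c)) Ssh.
  by rewrite -{1}[1]opprK shK.
move=> d; rewrite -[X in _ = X]/(S (u + v) v d) Ssh => /cu ->.
exact: shK.
Qed.

(* The standard symplectic form, on R^2g = R^g (+) R^g. *)
Definition omega (R : comNzRingType) (g : nat) (x y : 'rV[R]_(g + g)) : R :=
  \sum_(i < g) (x 0 (lshift g i) * y 0 (rshift g i)
                - x 0 (rshift g i) * y 0 (lshift g i)).

Definition HZ_to_H (g : nat) (v : 'rV[int]_(g + g)) : 'rV[rat]_(g + g) :=
  map_mx (intr : int -> rat) v.

Definition prim_vec (g : nat) : Type :=
  {v : 'rV[int]_(g + g) | `[< primitive v >]}.
HB.instance Definition _ g := SubChoice.on (prim_vec g).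

(* The sum v3 = v1 + v2 is automatically primitive, by [partial_basisD]. *)
Definition Sp_rel (g : nat) (r : {freeg (prim_vec g) / rat}) : Prop :=
  exists v1 v2 v3 : prim_vec g,
    [/\ partial_basis [:: \val v1; \val v2],
        omega (HZ_to_H (\val v1)) (HZ_to_H (\val v2)) = 0,
        \val v3 = \val v1 + \val v2
      & r = << v1 >> + << v2 >> - << v3 >>].

Definition Hg (g : nat) : lmodType rat := presented (@Sp_rel g).

Definition Sp_sym (g : nat) (v : prim_vec g) : Hg g := pgen (@Sp_rel g) v.

Lemma Phi_rel (g : nat) (r : {freeg (prim_vec g) / rat}) :
  Sp_rel r -> fglift (fun v : prim_vec g => HZ_to_H (\val v)) r = 0.
Proof.
case=> v1 [v2 [v3 [_ _ v3E ->]]]; rewrite raddfB raddfD /= !liftU !scale1r v3E.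
by rewrite /HZ_to_H map_mxD subrr.
Qed.

Definition Phi (g : nat) : {linear Hg g -> 'rV[rat]_(g + g)} :=
  plin (@Phi_rel g).

Lemma Phi_Sp_sym (g : nat) (v : prim_vec g) : Phi g (Sp_sym v) = HZ_to_H (\val v).
Proof. exact: plin_pgen. Qed.

(* Main.v *)
Require Import Defs.
From mathcomp Require Import all_boot all_order all_algebra.
From HB Require Import structures.
From mathcomp Require Import boolp freeg zify ring.

Set Implicit Arguments.
Unset Strict Implicit.
Unset Printing Implicit Defensive.

Import Order.TTheory GRing.Theory Num.Theory.
Local Open Scope ring_scope.
Local Open Scope quotient_scope.

(** The vectors of a standard symplectic basis e_1, ..., e_g, f_1, ..., f_g give
    2g symbols, so Phi has an obvious linear section Psi, sending a basis vector
    to its symbol. The content of the theorem is that Psi (Phi [v]) = [v], i.e.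
    that the symbol of a primitive vector is the combination of the symbols of
    the basis vectors given by its coordinates.

    This is shown for any function F from the lattice to a rational vector
    space with F (u + v) = F u + F v whenever u and v are orthogonal for omega
    and form a partial basis. Since omega is unimodular, the partial bases can
    be recognised by dual vectors: u is primitive iff omega u u' = 1 for some u'
    ([primitive_omega]), and {u, v} is a partial basis as soon as some u', v'
    pair with u, v as the identity matrix ([partial_basis_omega], from the Smith
    normal form). After that, everything is a computation with omega.

    The proof has three ingredients.
    - Euclid's algorithm ([basis_additive_linear]): a function on the primitive
      vectors of Z^2 that adds on every oriented basis is linear. On the span of
      an orthogonal partial basis this makes F linear on primitive vectors
      ([isotropic_linear]), and in particular odd.
    - Hyperbolic planes: if omega u v = 1 the relation between u and v is not
      available directly, but for a hyperbolic pair (a, b) orthogonal to u and v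
      the vectors u + a and v - b are orthogonal, and so are the two summands of
      (u + v) + (a - b). Comparing the two expansions, the defect
      F u + F v - F (u + v) depends on (a, b) only. It changes sign when (u, v)
      becomes (-u, -v), so it vanishes in characteristic 0
      ([hyperbolic_additive]). This is where g >= 2 enters, and by Euclid's
      algorithm again F is linear on the primitive vectors of each coordinate
      plane.
    - Induction on the number of coordinate planes: a vector is w + t with w in
      the first k planes and t in the next one; w and t are multiples of
      primitive vectors, and those two form an orthogonal partial basis, on the
      primitive vectors of whose span F is linear ([content_linear]). *)

(** * Euclid's algorithm *)

Definition basis_additive (V : zmodType) (f : int -> int -> V) : Prop :=
  forall x y p q : int, x * q - y * p = 1 ->
    f (x + p) (y + q) = f x y + f p q.

(** The hypothesis is stable under the changes of basis of Z^2 of determinant 1,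
    and by commutativity of addition under the exchange of coordinates, so one
    can induct on |x| + |y| for all functions at once: subtracting the smaller
    coordinate from the larger amounts to shearing f. *)
Lemma basis_additive_linear (V : zmodType) (f : int -> int -> V) :
  basis_additive f ->
  forall x y p q : int, x * q - y * p = 1 -> f x y = f 1 0 *~ x + f 0 1 *~ y.
Proof.
move=> fD x y p q; have [n] := ubnP (`|x| + `|y|)%N.
elim: n => // n IHn in f fD x y p q *.
wlog le_yx : f fD x y p q / (`|y| <= `|x|)%N => [wl | le_n det1].
  have [le_yx | lt_xy] := leqP `|y|%N `|x|%N; first exact: wl.
  move=> le_n det1; rewrite addrC.
  apply: (wl (fun u w => f w u) _ y x (- q) (- p)); rewrite ?(ltnW lt_xy) //.
  - move=> x' y' p' q' det1'; rewrite [RHS]addrC [y' + _]addrC [x' + _]addrC.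
    by apply: fD; rewrite -det1'; ring.
  - by rewrite addnC.
  - by rewrite -det1; ring.
(* Compare (1, 0) + (0, 1) = (1, 1) with (1, 1) + (-1, 0) = (0, 1). *)
have fN1 : f (-1) 0 = - f 1 0.
  have := fD 1 1 (-1) 0 erefl; have := fD 1 0 0 1 erefl.
  rewrite !(addr0, add0r, addrN, subrr) => -> /eqP.
  by rewrite addrAC -subr_eq subrr eq_sym addrC addr_eq0 => /eqP.
have [y0 | y_neq0] := eqVneq y 0.
  have [-> | ->] : x = 1 \/ x = -1.
    move: det1; rewrite y0 mul0r subr0 => /(congr1 absz)/eqP.
    by rewrite abszM muln_eq1 => /andP[/eqP]; lia.
  - by rewrite mulr1z y0 mulr0z addr0.
  - by rewrite y0 fN1 mulrN1z mulr0z addr0.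
have [e [e_pm1 lt_e]] : exists e : int,
    (e = 1 \/ e = -1) /\ (`|(x - e * y)%R| + `|y| < n)%N.
  have [y_gt0 | y_lt0 | y0] := ltrgt0P y; last by rewrite y0 eqxx in y_neq0.
    by have [x_ge0 | x_lt0] := lerP 0 x; [exists 1 | exists (-1)];
      (split; [by [left | right] | lia]).
  by have [x_ge0 | x_lt0] := lerP 0 x; [exists (-1) | exists 1];
    (split; [by [left | right] | lia]).
have fe1 : f e 1 = f 1 0 *~ e + f 0 1.
  case: e_pm1 => ->; first exact: (fD 1 0 0 1).
  by rewrite mulrN1z -fN1 addrC; apply: (fD 0 1 (-1) 0).
(* The sheared function, whose value at (x - e y, y) is f x y. *)
have gD : basis_additive (fun u w => f (u + e * w) w).
  move=> x' y' p' q' det1'; rewrite -fD; last by rewrite -det1'; ring.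
  by congr f; ring.
have /= := IHn _ gD (x - e * y) y (p - e * q) q lt_e.
rewrite subrK !(mulr0, mulr1, addr0, add0r) fe1 => ->; last first.
  by rewrite -det1; ring.
by rewrite mulrzDl mulrzBr mulrzA addrA subrK.
Qed.

(** * Partial bases and unimodular matrices *)

Lemma is_zbasis_rows (m n : nat) (B : 'M[int]_(m, n)) (C : 'M[int]_(n, m))
    (s : seq 'rV[int]_n) :
  B *m C = 1%:M -> C *m B = 1%:M -> size s = m ->
  (forall i : 'I_m, s`_i = row i B) -> is_zbasis s.
Proof.
move=> BC CB sz; subst m => sB w.
have combE (c : {ffun 'I_(size s) -> int}) :
    \sum_(i < size s) s`_i *~ c i = (\row_i c i) *m B.
  rewrite mulmx_sum_row; apply: eq_bigr => i _.
  by rewrite sB mxE -scaler_int intz.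
exists [ffun i => (w *m C) 0 i]; split.
  rewrite combE -[LHS]mulmx1 -CB mulmxA; congr (_ *m _).
  by apply/rowP => i; rewrite [RHS]mxE ffunE.
move=> c; rewrite combE => ->; apply/ffunP => i.
by rewrite ffunE -mulmxA BC mulmx1 mxE.
Qed.

(** A right inverse of M forces the elementary divisors of M to be units, so in
    the Smith normal form M = L D R the last rows of R complete those of M. *)
Lemma partial_basis_rows (m n : nat) (M : 'M[int]_(m, n)) (N : 'M[int]_(n, m))
    (s : seq 'rV[int]_n) :
  M *m N = 1%:M -> size s = m -> (forall i : 'I_m, s`_i = row i M) ->
  partial_basis s.
Proof.
move=> MN sz sM.
have [L Lu [R Ru [d _ ME]]] := int_Smith_normal_form M.
set D := (\matrix_(i, j) _) in ME.
have DK : D *m (R *m N *m L) = 1%:M.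
  by rewrite !mulmxA; apply: mulmx1C; rewrite !mulmxA -ME.
have le_mn : (m <= n)%N.
  rewrite leqNgt; apply/negP => lt_nm.
  have /matrixP/(_ (Ordinal lt_nm) (Ordinal lt_nm)) := DK.
  rewrite !mxE eqxx big1 // => j _; rewrite !mxE /=.
  by rewrite gtn_eqF // mul0r.
have [k nE] : exists k, n = (m + k)%N by exists (n - m)%N; rewrite subnKC.
subst n.
set K := R *m N *m L in DK.
have D0 : rsubmx D = 0.
  apply/matrixP => i j; rewrite !mxE /= ltn_eqF //.
  exact: leq_trans (ltn_ord i) (leq_addr _ _).
have D1K : lsubmx D *m usubmx K = 1%:M.
  by rewrite -DK -{2}[D]hsubmxK -{2}[K]vsubmxK mul_row_col D0 mul0mx addr0.
have D1u : lsubmx D \in unitmx by have [] := mulmx1_unit D1K.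
pose B := block_mx (L *m lsubmx D) 0 0 1%:M *m R.
have Bu : B \in unitmx.
  rewrite unitmx_mul Ru unitmxE det_ublock det1 mulr1 -unitmxE.
  by rewrite unitmx_mul Lu D1u.
have uB : usubmx B = M.
  rewrite /B block_mxEv mul_col_mx col_mxKu ME -[in RHS](hsubmxK D) D0.
  by rewrite mul_mx_row mulmx0.
exists [seq row i (dsubmx B) | i <- enum 'I_k].
apply: (@is_zbasis_rows _ _ B (invmx B)).
- exact: mulmxV.
- exact: mulVmx.
- by rewrite size_cat size_map size_enum_ord sz.
move=> i; rewrite nth_cat sz -[i]splitK; case: split => j /=.
  by rewrite ltn_ord sM -uB; apply/rowP => l; rewrite !mxE.
rewrite ltnNge leq_addr /= addKn (nth_map j) ?size_enum_ord // nth_ord_enum.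
by apply/rowP => l; rewrite !mxE.
Qed.

(** * The symplectic form *)

Section Symplectic.

Context {R : comNzRingType} {g : nat}.
Implicit Types u v w : 'rV[R]_(g + g).

(** The column of the linear form omega _ v. *)
Definition omega_dual v : 'cV[R]_(g + g) := (row_mx (rsubmx v) (- lsubmx v))^T.

Lemma mul_omega_dual u v : u *m omega_dual v = (omega u v)%:M.
Proof.
apply/rowP => i; rewrite !ord1 !mxE big_split_ord /= mulr1n.
rewrite -big_split /=; apply: eq_bigr => j _.
by rewrite !mxE (unsplitK (inl j)) (unsplitK (inr j)) !mxE mulrN.
Qed.

Lemma omega_dual_surj (c : 'cV[R]_(g + g)) : exists v, c = omega_dual v.
Proof.
exists (row_mx (- (dsubmx c)^T) (usubmx c)^T).
by rewrite /omega_dual row_mxKl row_mxKr opprK tr_row_mx !trmxK vsubmxK.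
Qed.

Lemma omegaC u v : omega u v = - omega v u.
Proof.
rewrite /omega -sumrN; apply: eq_bigr => i _.
by rewrite opprB mulrC [X in _ - X]mulrC.
Qed.

Lemma omegavv v : omega v v = 0.
Proof. by rewrite /omega big1 // => i _; rewrite mulrC subrr. Qed.

Lemma omega_is_additive_r u : zmod_morphism (omega u).
Proof.
move=> v w; rewrite /omega -sumrB; apply: eq_bigr => i _; rewrite !mxE; ring.
Qed.

HB.instance Definition _ u :=
  GRing.isZmodMorphism.Build _ _ (omega u) (omega_is_additive_r u).

Lemma omegaDr u v w : omega u (v + w) = omega u v + omega u w.
Proof. exact: raddfD. Qed.

Lemma omegaNr u v : omega u (- v) = - omega u v.
Proof. exact: raddfN. Qed.

Lemma omegaMzr u v (n : int) : omega u (v *~ n) = omega u v *~ n.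
Proof. exact: raddfMz. Qed.

Lemma omegaDl u v w : omega (u + v) w = omega u w + omega v w.
Proof. by rewrite omegaC omegaDr opprD (omegaC u) (omegaC v). Qed.

Lemma omegaNl u v : omega (- u) v = - omega u v.
Proof. by rewrite omegaC omegaNr (omegaC u). Qed.

Lemma omegaMzl u v (n : int) : omega (u *~ n) v = omega u v *~ n.
Proof. by rewrite omegaC omegaMzr -mulNrz (omegaC u). Qed.

Lemma omega_lshift (i : 'I_g) u :
  omega (delta_mx 0 (lshift g i)) u = u 0 (rshift g i).
Proof.
rewrite /omega (bigD1 i) //= big1 => [|j ne_ji].
  by rewrite !mxE !eqxx eq_rlshift mul1r mul0r subr0 addr0.
rewrite !mxE eq_rlshift (inj_eq (@lshift_inj _ _)) (negPf ne_ji).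
by rewrite !mul0r subr0.
Qed.

Lemma omega_rshift (i : 'I_g) u :
  omega (delta_mx 0 (rshift g i)) u = - u 0 (lshift g i).
Proof.
rewrite /omega (bigD1 i) //= big1 => [|j ne_ji].
  by rewrite !mxE !eqxx eq_lrshift mul1r mul0r sub0r addr0.
rewrite !mxE eq_lrshift (inj_eq (@rshift_inj _ _)) (negPf ne_ji).
by rewrite !mul0r subr0.
Qed.

End Symplectic.

Lemma omega_HZ_to_H (g : nat) (u v : 'rV[int]_(g + g)) :
  omega (HZ_to_H u) (HZ_to_H v) = (omega u v)%:~R.
Proof.
rewrite /omega rmorph_sum; apply: eq_bigr => i _.
by rewrite rmorphB /= !rmorphM /= !mxE.
Qed.

Lemma partial_basis_omega (g : nat) (u v u' v' : 'rV[int]_(g + g)) :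
  omega u u' = 1 -> omega u v' = 0 -> omega v u' = 0 -> omega v v' = 1 ->
  partial_basis [:: u; v].
Proof.
move=> uu uv vu vv.
apply: (@partial_basis_rows (1 + 1) _ (col_mx u v)
                            (row_mx (omega_dual u') (omega_dual v'))) => //.
  rewrite mul_col_row !mul_omega_dual uu uv vu vv.
  by rewrite !raddf0 -scalar_mx_block.
move=> i; rewrite -[i]splitK; case: split => j /=.
  by rewrite ord1 rowKu row_id.
by rewrite ord1 rowKd row_id.
Qed.

(** If v is the first vector of a basis, the corresponding coordinate is a linear
    form with value 1 at v, and every linear form is omega _ v' for some v'. *)
Lemma primitive_omega (g : nat) (v : 'rV[int]_(g + g)) :
  primitive v <-> exists v', omega v v' = 1.
Proof.
split=> [[t tb] | [v' vv']]; last first.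
  apply: (@partial_basis_rows 1 _ v (omega_dual v')) => //.
    by rewrite mul_omega_dual vv'.
  by move=> i; rewrite ord1 row_id.
set s := ([:: v] ++ t) in tb.
have [c cE] : exists c : 'I_(g + g) -> {ffun 'I_(size s) -> int},
    forall j, delta_mx 0 j = \sum_(i < size s) s`_i *~ c j i.
  have /choice[c cE] (j : 'I_(g + g)) : exists cj : {ffun 'I_(size s) -> int},
    delta_mx 0 j = \sum_(i < size s) s`_i *~ cj i :> 'rV[int]_(g + g).
    by have [cj [cjE _]] := tb (delta_mx 0 j); exists cj.
  by exists c.
have [c' [_ c'u]] := tb v.
(* The coordinates of v, read off in two ways: v is the head of s, and v is a
   combination of the standard basis vectors. *)
have e1 : c' = [ffun i => (i == ord0)%:R].
  apply: c'u; rewrite big_ord_recl big1 => [|i _];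
    by rewrite !ffunE ?mulr1z ?addr0.
have e2 : c' = [ffun i => \sum_j v 0 j * c j i].
  apply: c'u; rewrite {1}(row_sum_delta v).
  under eq_bigr => j _ do rewrite cE scaler_sumr.
  rewrite exchange_big /=; apply: eq_bigr => i _; rewrite ffunE mulrz_sumr.
  by apply: eq_bigr => j _; rewrite mulrC mulrzA -[RHS]scaler_int intz.
have [v' v'E] := omega_dual_surj (\col_j c j ord0).
exists v'; have /matrixP/(_ 0 0) := mul_omega_dual v v'.
rewrite [RHS]mxE mulr1n => <-; rewrite -v'E mxE.
have := congr1 (fun f : {ffun _ -> int} => f ord0) (etrans (esym e2) e1).
rewrite !ffunE /= => cv1; rewrite -[RHS]cv1.
by apply: eq_bigr => j _; rewrite mxE.
Qed.

(** * Functions additive on orthogonal partial bases *)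

(** The vectors u' and v' certify that u and v form a partial basis. *)
Definition isotropic_additive (V : zmodType) (g : nat)
    (F : 'rV[int]_(g + g) -> V) : Prop :=
  forall u v u' v', omega u u' = 1 -> omega u v' = 0 -> omega v u' = 0 ->
    omega v v' = 1 -> omega u v = 0 -> F (u + v) = F u + F v.

Definition omegaE := (@omegaDl, @omegaDr, @omegaNl, @omegaNr, @omegaMzl,
  @omegaMzr, @omegavv).

Section IsotropicAdditive.

Context (V : lmodType rat) (g : nat) (F : 'rV[int]_(g + g) -> V).
Hypothesis F_iso : isotropic_additive F.
Implicit Types (u v w : 'rV[int]_(g + g)) (x y p q : int).

(** A change of basis of the span of u and v acts on the dual pair (u', v') by the
    inverse transpose, so the hypotheses hold for every basis of this span. *)
Lemma isotropic_linear u v u' v' x y p q :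
  omega u u' = 1 -> omega u v' = 0 -> omega v u' = 0 -> omega v v' = 1 ->
  omega u v = 0 -> x * q - y * p = 1 ->
  F (u *~ x + v *~ y) = F u *~ x + F v *~ y.
Proof.
move=> uu' uv' vu' vv' uv.
have vu : omega v u = 0 by rewrite omegaC uv oppr0.
have E := (omegaE, uu', uv', vu', vv', uv, vu).
pose f x y := F (u *~ x + v *~ y).
have fD : basis_additive f.
  move=> {}x {}y {}p {}q det1; rewrite /f !mulrzDr addrACA.
  apply: (F_iso (u' := u' *~ q - v' *~ p) (v' := v' *~ x - u' *~ y));
    rewrite !E !mulrzz; lia.
by move=> /(basis_additive_linear fD); rewrite /f !mulr1z !mulr0z addr0 add0r.
Qed.

Lemma isotropicN u v u' v' :
  omega u u' = 1 -> omega u v' = 0 -> omega v u' = 0 -> omega v v' = 1 ->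
  omega u v = 0 -> F (- u) = - F u.
Proof.
move=> uu' uv' vu' vv' uv.
have := @isotropic_linear u v u' v' (-1) 0 0 (-1) uu' uv' vu' vv' uv erefl.
by rewrite !mulrN1z !mulr0z !addr0.
Qed.

Definition symplectic_quad u v a b : Prop :=
  [/\ omega u v = 1, omega a b = 1 &
      [/\ omega u a = 0, omega u b = 0, omega v a = 0 & omega v b = 0]].

(** Both sides are what remains when u + v + a - b is expanded as
    (u + a) + (v - b) and as (u + v) + (a - b). *)
Lemma hyperbolic_defect u v a b : symplectic_quad u v a b ->
  F u + F v - F (u + v) = F (a - b) - F a - F (- b).
Proof.
case=> uv ab [ua ub va vb].
have vu : omega v u = -1 by rewrite omegaC uv.
have ba : omega b a = -1 by rewrite omegaC ab.
have au : omega a u = 0 by rewrite omegaC ua oppr0.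
have av : omega a v = 0 by rewrite omegaC va oppr0.
have bu : omega b u = 0 by rewrite omegaC ub oppr0.
have bv : omega b v = 0 by rewrite omegaC vb oppr0.
have E := (omegaE, uv, ab, ua, ub, va, vb, vu, ba, au, av, bu, bv).
have Fua : F (u + a) = F u + F a.
  by apply: (F_iso (u' := v) (v' := b)); rewrite !E; lia.
have Fvb : F (v - b) = F v + F (- b).
  by apply: (F_iso (u' := - u) (v' := a)); rewrite !E; lia.
have Fuvab : F (u + v + (a - b)) = F (u + v) + F (a - b).
  by apply: (F_iso (u' := v) (v' := b)); rewrite !E; lia.
have Fcross : F ((u + a) + (v - b)) = F (u + a) + F (v - b).
  by apply: (F_iso (u' := v) (v' := - u)); rewrite !E; lia.
have := Fcross; rewrite addrACA Fuvab.
rewrite Fua Fvb [RHS]addrACA => Eq.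
apply/eqP; rewrite -[X in _ == X]addrA -opprD subr_eq addrAC eq_sym subr_eq -Eq.
by rewrite addrC.
Qed.

(** The right-hand side of [hyperbolic_defect] does not see u and v, whereas its
    left-hand side is odd in (u, v). *)
Lemma hyperbolic_additive u v a b : symplectic_quad u v a b ->
  F (u + v) = F u + F v.
Proof.
move=> quad; have [uv ab [ua ub va vb]] := quad.
have quadN : symplectic_quad (- u) (- v) a b.
  by rewrite /symplectic_quad !omegaE uv ab ua ub va vb.
have FN w w' : omega w w' = 1 -> omega w a = 0 -> omega w b = 0 ->
    omega w' a = 0 -> F (- w) = - F w.
  move=> ww' wa wb w'a.
  apply: (isotropicN (v := a) (u' := w') (v' := b)) => //.
  by rewrite omegaC w'a oppr0.
have FNu : F (- u) = - F u by apply: (FN u v).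
have FNv : F (- v) = - F v.
  by apply: (FN v (- u)); rewrite ?omegaE ?ua ?oppr0 // omegaC opprK.
have FNuv : F (- u - v) = - F (u + v).
  by rewrite -opprD; apply: (FN (u + v) v); rewrite ?omegaE ?uv ?ua ?ub ?va ?vb.
have := hyperbolic_defect quadN; rewrite -(hyperbolic_defect quad).
rewrite FNu FNv FNuv -!opprD => /eqP; rewrite eq_sym -addr_eq0 -mulr2n.
by rewrite -scaler_nat scaler_eq0 /= subr_eq0 => /eqP.
Qed.

Lemma hyperbolic_linear u v a b x y p q : symplectic_quad u v a b ->
  x * q - y * p = 1 -> F (u *~ x + v *~ y) = F u *~ x + F v *~ y.
Proof.
case=> uv ab [ua ub va vb].
have vu : omega v u = -1 by rewrite omegaC uv.
pose f x y := F (u *~ x + v *~ y).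
have fD : basis_additive f.
  move=> {}x {}y {}p {}q det1; rewrite /f !mulrzDr addrACA.
  apply: (@hyperbolic_additive _ _ a b).
  rewrite /symplectic_quad !omegaE uv vu ua ub va vb ab !mulrzz.
  by split=> //; [lia | split; lia].
by move=> /(basis_additive_linear fD); rewrite /f !mulr1z !mulr0z addr0 add0r.
Qed.

Definition basis_extension v : V := \sum_j F (delta_mx 0 j) *~ v 0 j.

Local Notation e i := (delta_mx 0 (lshift g i) : 'rV[int]_(g + g)).
Local Notation f i := (delta_mx 0 (rshift g i) : 'rV[int]_(g + g)).

Lemma entryMz (n : nat) (v : 'rV[int]_n) x j : (v *~ x) 0 j = v 0 j * x.
Proof. by rewrite -scaler_int intz mxE mulrC. Qed.

Lemma basis_extension_linear u v x y :
  basis_extension (u *~ x + v *~ y) =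
  basis_extension u *~ x + basis_extension v *~ y.
Proof.
rewrite /basis_extension !mulrz_suml -big_split; apply: eq_bigr => j _ /=.
by rewrite mxE !entryMz mulrzDr !mulrzA.
Qed.

Lemma basis_extension_delta j : basis_extension (delta_mx 0 j) = F (delta_mx 0 j).
Proof.
rewrite /basis_extension (bigD1 j) //= big1 => [|i ne_ij].
  by rewrite mxE !eqxx mulr1z addr0.
by rewrite mxE (negPf ne_ij) mulr0z.
Qed.

(** For x = y = 0 the pair (p, q) is an arbitrary primitive vector: this keeps the
    decomposition uniform, with content d = 0. *)
Lemma gcdz_cofactors x y : exists d p q r s : int,
  [/\ x = p * d, y = q * d & p * s - q * r = 1].
Proof.
have [r [s gE]] := Bezoutz x y.
have [g0 | g_neq0] := eqVneq (gcdz x y) 0.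
  move/eqP: g0; rewrite gcdz_eq0 => /andP[/eqP-> /eqP->].
  by exists 0, 1, 0, 0, 1.
have /dvdzP[p xE] := dvdz_gcdl x y; have /dvdzP[q yE] := dvdz_gcdr x y.
exists (gcdz x y), p, q, (- s), r; split=> //.
apply: (mulIf g_neq0); rewrite mul1r -[RHS]gE.
transitivity (r * (p * gcdz x y) + s * (q * gcdz x y)); first by ring.
by rewrite -xE -yE.
Qed.

Hypothesis g_ge2 : (2 <= g)%N.

Lemma symplectic_quad_planes (i : 'I_g) :
  exists j, symplectic_quad (e i) (f i) (e j) (f j).
Proof.
have [j ne_ij] : exists j : 'I_g, i != j.
  have [i0 | i_neq0] := eqVneq (i : nat) 0%N.
    by exists (Ordinal g_ge2); rewrite -val_eqE /= i0.
  by exists (Ordinal (ltnW g_ge2)); rewrite -val_eqE.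
exists j; rewrite /symplectic_quad !omega_lshift !omega_rshift !mxE !eqxx /=.
by rewrite !eq_lrshift !eq_rlshift !eq_lshift !eq_rshift (negPf ne_ij).
Qed.

Definition supported (k : nat) v : Prop :=
  forall j : 'I_g, (k <= j)%N -> v 0 (lshift g j) = 0 /\ v 0 (rshift g j) = 0.

(** The dual vector v' is required to have the same support as v so that it stays
    orthogonal to the planes added later. The value at - v is recorded because a
    primitive vector is only determined by its multiples up to sign. *)
Definition linear_dual_pair (k : nat) v v' : Prop :=
  [/\ omega v v' = 1, supported k v, supported k v',
      F v = basis_extension v & F (- v) = - basis_extension v].

Lemma plane_content (i : 'I_g) x y :
  exists d p q r s, [/\ e i *~ x + f i *~ y = (e i *~ p + f i *~ q) *~ d
    & linear_dual_pair i.+1 (e i *~ p + f i *~ q) (e i *~ r + f i *~ s)].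
Proof.
have [d [p [q [r [s [-> -> det1]]]]]] := gcdz_cofactors x y.
exists d, p, q, r, s; split; first by rewrite mulrzDl !mulrzA.
have [j quad] := symplectic_quad_planes i; have [ef _ _] := quad.
have fe : omega (f i) (e i) = -1 by rewrite omegaC ef.
have sup p' q' : supported i.+1 (e i *~ p' + f i *~ q').
  move=> l lt_il; rewrite !mxE !entryMz !mxE /= !eq_lrshift !eq_rlshift.
  by rewrite !eq_lshift !eq_rshift -val_eqE /= gtn_eqF //= !mul0r.
split=> //.
- by rewrite !omegaE ef fe !mulrzz; lia.
- rewrite (hyperbolic_linear quad det1).
  by rewrite basis_extension_linear !basis_extension_delta.
rewrite opprD -!mulrNz (hyperbolic_linear (p := - r) (q := - s) quad); last lia.
by rewrite !mulrNz -opprD basis_extension_linear !basis_extension_delta.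
Qed.

(** When a plane is added, the primitive vectors w (from the old planes) and u
    (from the new one) form an orthogonal partial basis, certified by their dual
    vectors w' and u' because these have the same supports. So [isotropic_linear]
    applies to the primitive vector in the direction of any combination of w and
    u. Finding this vector and the linearity of F there in the same induction
    provides the dual vectors at each step. *)
Lemma content_linear (k : nat) v : (0 < k <= g)%N ->
  exists d v' v'', linear_dual_pair k v' v'' /\
    \sum_(j < g | (j < k)%N) (e j *~ v 0 (lshift g j) + f j *~ v 0 (rshift g j))
    = v' *~ d.
Proof.
elim: k => // k IHk lt_kg.
pose i := Ordinal (lt_kg : (k < g)%N).
have [d2 [p [q [r [s [planeE dual_u]]]]]] :=
  plane_content i (v 0 (lshift g i)) (v 0 (rshift g i)).
set u := e i *~ p + f i *~ q in planeE dual_u.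
set u' := e i *~ r + f i *~ s in dual_u.
rewrite (bigD1 i) //= planeE.
rewrite (eq_bigl (fun j : 'I_g => (j < k)%N)) => [|j]; last first.
  by rewrite ltnS -val_eqE /= andbC -ltn_neqAle.
have [k0 | k_gt0] := posnP k.
  exists d2, u, u'; split; first by rewrite -[k]/(i : nat).
  by rewrite big1 ?addr0 // => j; rewrite k0.
have [|d1 [w [w' [dual_w ->]]]] := IHk; first by rewrite k_gt0 ltnW.
have [ww' sw sw' Fw _] := dual_w; have [uu' su su' Fu _] := dual_u.
have [d [P [Q [R [S [-> -> det1]]]]]] := gcdz_cofactors d1 d2.
have plane_ortho z p' q' : supported k z -> omega (e i *~ p' + f i *~ q') z = 0.
  move=> /(_ i (leqnn k))[zl zr].
  by rewrite !omegaE omega_lshift omega_rshift zl zr oppr0 !mul0rz addr0.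
have uw : omega u w = 0 by apply: plane_ortho.
have uw' : omega u w' = 0 by apply: plane_ortho.
have wu : omega w u = 0 by rewrite omegaC uw oppr0.
have wu' : omega w u' = 0 by rewrite omegaC plane_ortho ?oppr0.
clearbody u u'.
have supD z t m n : supported k z -> supported k.+1 t ->
    supported k.+1 (z *~ m + t *~ n).
  move=> sz st j lt_kj; have [zl zr] := sz j (ltnW lt_kj).
  by have [tl tr] := st j lt_kj; rewrite !mxE !entryMz zl zr tl tr !mul0r addr0.
have Flin m n l o : m * o - n * l = 1 ->
    F (w *~ m + u *~ n) = basis_extension (w *~ m + u *~ n).
  move=> det1'; rewrite (isotropic_linear ww' wu' uw' uu' wu det1').
  by rewrite basis_extension_linear Fw Fu.
exists d, (w *~ P + u *~ Q), (w' *~ S + u' *~ (- R)); split; last first.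
  by rewrite addrC !mulrzA -mulrzDl.
split; [| exact: supD | exact: supD | exact: Flin det1 |].
  by rewrite !omegaE ww' wu' uw' uu' !mulrzz; lia.
rewrite opprD -!mulrNz (Flin _ _ (- R) (- S)); last by lia.
by rewrite !basis_extension_linear !mulrNz -opprD.
Qed.

Lemma isotropic_additive_linear v v' :
  omega v v' = 1 -> F v = basis_extension v.
Proof.
move=> vv'; have [|d [w [w' [[_ _ _ Fw FNw]]]]] := @content_linear g v.
  by rewrite leqnn ltnW.
have <- : v = \sum_(j < g | (j < g)%N)
    (e j *~ v 0 (lshift g j) + f j *~ v 0 (rshift g j)).
  rewrite {1}[v]row_sum_delta big_split_ord /= -big_split /=.
  by apply: eq_big => [j | j _]; rewrite ?ltn_ord // -!scaler_int !intz.
move=> vE.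
have [d1 | dN1] : d = 1 \/ d = -1.
  move: vv'; rewrite vE omegaMzl mulrzz => /(congr1 absz)/eqP.
  by rewrite abszM muln_eq1 => /andP[_ /eqP]; lia.
- by rewrite vE d1 mulr1z.
- rewrite vE dN1 mulrN1z FNw.
  have := basis_extension_linear w 0 (-1) 0.
  by rewrite !mulrN1z !mulr0z !addr0.
Qed.

End IsotropicAdditive.

(** * The presented space *)

Lemma pi_rel (K : nzRingType) (X : choiceType)
    (rels : {freeg X / K} -> Prop) r :
  rels r -> \pi_(presented rels) r = 0.
Proof.
move=> rel_r; rewrite -[RHS](raddf0 (\pi_(presented rels))).
apply/eqP; rewrite -Quotient.idealrBE subr0; apply/asboolP.
exists [:: (1, r)]; split; last by rewrite big_seq1 scale1r.
by move=> p; rewrite inE => /eqP->.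
Qed.

Lemma presented_linear_ext (K : nzRingType) (X : choiceType)
    (rels : {freeg X / K} -> Prop) (M : lmodType K)
    (f h : {linear presented rels -> M}) :
  (forall x, f (pgen rels x) = h (pgen rels x)) -> f =1 h.
Proof.
move=> fh; elim/quotW=> D; elim/freeg_ind_dom0: D => [|k x D _ _ IH].
  by rewrite !raddf0.
rewrite !raddfD /= IH; congr (_ + _).
have -> : << k *g x >> = k *: << x >> :> {freeg X / K}.
  by apply/eqP/freeg_eqP => y; rewrite coeffZ !coeffU mul1r.
by rewrite pi_presentedZ !linearZ /= -/(pgen rels x) fh.
Qed.

Section TotalSymbol.

Context {g : nat}.
Implicit Types v : 'rV[int]_(g + g).

(** A function on the whole lattice, so that sums of vectors can be formed without
    carrying proofs of primitivity. *)
Definition total_sym v : Hg g :=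
  if insub v is Some p then Sp_sym (p : prim_vec g) else 0.

Lemma total_symE (p : prim_vec g) v : val p = v -> total_sym v = Sp_sym p.
Proof. by move=> <-; rewrite /total_sym valK. Qed.

Lemma total_sym_isotropic_additive : isotropic_additive total_sym.
Proof.
move=> u v u' v' uu' uv' vu' vv' uv.
have pu : `[< primitive u >] by apply/asboolP/primitive_omega; exists u'.
have pv : `[< primitive v >] by apply/asboolP/primitive_omega; exists v'.
have pb := partial_basis_omega uu' uv' vu' vv'.
have puv : `[< primitive (u + v) >] by apply/asboolP/partial_basisD.
rewrite (@total_symE (exist _ u pu) u erefl) (@total_symE (exist _ v pv) v erefl).
rewrite (@total_symE (exist _ (u + v) puv) (u + v) erefl); apply/eqP.
rewrite eq_sym -subr_eq0 /Sp_sym /pgen -raddfD -raddfB; apply/eqP/pi_rel.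
exists (exist _ u pu), (exist _ v pv), (exist _ (u + v) puv).
by split=> //; rewrite omega_HZ_to_H uv.
Qed.

End TotalSymbol.

Theorem theorem3 (g : nat) (hg : (2 <= g)%N) : bijective (Phi g).
Proof.
pose e j : 'rV[int]_(g + g) := delta_mx 0 j.
pose psi (y : 'rV[rat]_(g + g)) : Hg g := \sum_j y 0 j *: total_sym (e j).
have psi_lin : linear psi.
  move=> a y z; rewrite /psi scaler_sumr -big_split; apply: eq_bigr => j _ /=.
  by rewrite !mxE scalerDl scalerA.
pose Psi : {linear 'rV[rat]_(g + g) -> Hg g} :=
  HB.pack psi (GRing.isLinear.Build _ _ _ _ psi psi_lin).
have PsiZ v : Psi (HZ_to_H v) = basis_extension total_sym v.
  by apply: eq_bigr => j _; rewrite mxE scaler_int.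
exists Psi.
  apply: (@presented_linear_ext _ _ _ _ (Psi \o Phi g) idfun) => p.
  rewrite -[LHS]/(Psi (Phi g (Sp_sym p))) -[RHS]/(Sp_sym p) Phi_Sp_sym PsiZ.
  have [v' vv'] := (primitive_omega _).1 (elimT (asboolP _) (valP p)).
  rewrite -(isotropic_additive_linear (@total_sym_isotropic_additive g) hg vv').
  exact: total_symE.
move=> y; rewrite [Psi y]/(psi y) linear_sum [RHS]row_sum_delta.
apply: eq_bigr => j _; rewrite linearZZ; congr (_ *: _).
have prim_e : `[< primitive (e j) >].
  apply/asboolP/primitive_omega; have [v' v'E] := omega_dual_surj (e j)^T.
  exists v'; have /matrixP/(_ 0 0) := mul_omega_dual (e j) v'.
  rewrite [RHS]mxE mulr1n => <-; rewrite -v'E trmx_delta mul_delta_mx.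
  by rewrite mxE.
rewrite (@total_symE _ (exist _ (e j) prim_e) (e j) erefl) Phi_Sp_sym /= /HZ_to_H.
by rewrite map_delta_mx.
Qed.
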